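(* Let $k\ge 6$ and $n=2k$ be integers and let $s$ be an integer with $2\le s\le k-3$. Let $S_1=\{1,2,\ldots,s,n-s,\ldots,n-2,n-1\}\subseteq\mathbb{Z}_n$ and $S_2=\{k-s,\ldots,k-1,k+1,\ldots,k+s\}\subseteq\mathbb{Z}_n$. Then the circulant graphs $G_1=G(\mathbb{Z}_n,S_1)$ and $G_2=G(\mathbb{Z}_n,S_2)$ are singularly cospectral but not cospectral.
   Context: For a positive integer $n$ and a set $S\subseteq\mathbb{Z}_n\setminus\{0\}$ with $S=-S$, the circulant graph $G(\mathbb{Z}_n,S)$ has vertex set $\mathbb{Z}_n$, with $i$ and $j$ adjacent iff $j-i\in S$. All eigenvalues are eigenvalues of the adjacency matrix. Two graphs are cospectral if their adjacency matrices have the same eigenvalues with multiplicities. Two graphs on the same number of vertices are singularly cospectral if the multisets of absolute values of their nonzero adjacency eigenvalues (counted with multiplicity) coincide. *)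

(* Defs.v *)
From HB Require Import structures.
From mathcomp Require Import all_boot all_order all_algebra.
From mathcomp Require Import zify.

Set Implicit Arguments.
Unset Strict Implicit.
Unset Printing Implicit Defensive.

Import Order.TTheory GRing.Theory Num.Theory.
Local Open Scope ring_scope.

(* 'Z_n is the ring of integers modulo n only when 1 < n. *)
Definition circulant (n : nat) (S : {set 'Z_n}) : rel 'Z_n :=
  fun i j => j - i \in S.

(* S is a subset of Z_n \ {0} with S = -S. *)
Definition connection_set (n : nat) (S : {set 'Z_n}) : Prop :=
  0 \notin S /\ [set - x | x in S] = S.

Lemma circulant_irrefl (n : nat) (S : {set 'Z_n}) :
  connection_set S -> irreflexive (circulant S).
Proof. by case=> S0 _ x; rewrite /circulant subrr; apply: negbTE. Qed.

Lemma circulant_sym (n : nat) (S : {set 'Z_n}) :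
  connection_set S -> symmetric (circulant S).
Proof.
case=> _ SN x y; rewrite /circulant -[in RHS]SN -[x - y]opprB.
by rewrite mem_imset //; apply: oppr_inj.
Qed.

Definition adjacency (C : numClosedFieldType) (m : nat) (e : rel 'I_m) :
    'M[C]_m :=
  \matrix_(i, j) (e i j)%:R.

(* The eigenvalues of A listed with (algebraic) multiplicity, in an
   unspecified order; see eigenvaluesP. *)
Definition eigenvalues (C : numClosedFieldType) (m : nat) (A : 'M[C]_m) :
    seq C :=
  sval (closed_field_poly_normal (char_poly A)).

Lemma eigenvaluesP (C : numClosedFieldType) (m : nat) (A : 'M[C]_m) :
  char_poly A = \prod_(z <- eigenvalues A) ('X - z%:P).
Proof.
rewrite /eigenvalues; case: closed_field_poly_normal => r /= ->.
by rewrite (monicP (char_poly_monic A)) scale1r.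
Qed.

Lemma mem_eigenvalues (C : numClosedFieldType) (m : nat) (A : 'M[C]_m)
    (a : C) :
  (a \in eigenvalues A) = eigenvalue A a.
Proof. by rewrite eigenvalue_root_char eigenvaluesP root_prod_XsubC. Qed.

Definition cospectral (C : numClosedFieldType) (m : nat)
    (e1 e2 : rel 'I_m) : Prop :=
  perm_eq (eigenvalues (adjacency C e1)) (eigenvalues (adjacency C e2)).

Definition abs_nonzero_eigenvalues (C : numClosedFieldType) (m : nat)
    (e : rel 'I_m) : seq C :=
  [seq `|x| | x <- eigenvalues (adjacency C e) & x != 0].

Definition singularly_cospectral (C : numClosedFieldType) (m : nat)
    (e1 e2 : rel 'I_m) : Prop :=
  perm_eq (abs_nonzero_eigenvalues C e1) (abs_nonzero_eigenvalues C e2).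

(* Elements of 'Z_n are compared through their representatives in [0, n). *)
Definition conn1 (n s : nat) : {set 'Z_n} :=
  [set x : 'Z_n | (1 <= x <= s)%N || (n - s <= x <= n - 1)%N].

Definition conn2 (n k s : nat) : {set 'Z_n} :=
  [set x : 'Z_n | (k - s <= x <= k - 1)%N || (k + 1 <= x <= k + s)%N].

Lemma connection_setP (n : nat) (S : {set 'Z_n}) :
  0 \notin S -> (forall x, x \in S -> - x \in S) -> connection_set S.
Proof.
move=> S0 SN; split=> //; apply/setP=> x; apply/imsetP/idP.
  by case=> y /SN yS ->.
by move=> /SN xS; exists (- x); rewrite ?opprK.
Qed.

Lemma ltn_Zp (n : nat) (x : 'Z_n) : (1 < n)%N -> (x < n)%N.
Proof. by move=> n1; have := ltn_ord x; move: (nat_of_ord x) => y; rewrite Zp_cast. Qed.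

Lemma val_oppZ (n : nat) (x : 'Z_n) :
  (1 < n)%N -> (- x : 'Z_n) = (if x == 0%N :> nat then 0 else n - x)%N :> nat.
Proof.
move=> n1; have := ltn_Zp x n1; rewrite /=; move: (nat_of_ord x) => y.
rewrite Zp_cast //; case: eqP => [->|x0] xn; first by rewrite subn0 modnn.
by rewrite modn_small //; lia.
Qed.

Lemma conn1_connection_set (n s : nat) :
  (1 < n)%N -> (s < n)%N -> connection_set (conn1 n s).
Proof.
move=> n1 sn; apply: connection_setP => [|x]; rewrite !inE //=; first by lia.
have := ltn_Zp x n1.
by have /= -> := val_oppZ x n1; case: eqP; lia.
Qed.

Lemma conn2_connection_set (n k s : nat) :
  n = (2 * k)%N -> (s < k)%N -> connection_set (conn2 n k s).
Proof.
move=> nk sk; have n1 : (1 < n)%N by lia.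
apply: connection_setP => [|x]; rewrite !inE //=; first by lia.
have := ltn_Zp x n1.
by have /= -> := val_oppZ x n1; case: eqP; lia.
Qed.

(* Main.v *)
Require Import Defs.
From HB Require Import structures.
From mathcomp Require Import all_boot all_order all_algebra.
From mathcomp Require Import all_solvable all_field zify.

Set Implicit Arguments.
Unset Strict Implicit.
Unset Printing Implicit Defensive.

Import Order.TTheory GRing.Theory Num.Theory.
Local Open Scope ring_scope.

(* Let w be a primitive n-th root of unity. The Fourier matrix diagonalises
   every circulant adjacency matrix, the eigenvalues being
   lambda_j(S) = \sum_(x in S) w^(jx). Since S_2 = k + S_1 and w^k = -1,
   lambda_j(S_2) = (-1)^j lambda_j(S_1): same absolute values.

   Cospectrality would force equal sums of cubes, i.e. equal numbers of pairs
   (a, b) in S x S with a + b in S. For odd j the eigenvalues of S_1 are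
   unchanged when s is replaced by k - 1 - s, and even j contribute nothing to
   the difference of the two sums of cubes, so one may assume 2s < k. Then an
   injection of the pairs of S_2 into those of S_1, missing (1, -2), shows that
   S_1 has strictly more of them. *)

(** * Preliminaries on roots of unity, similarity and residues *)

Lemma prim_root_exists_closed (C : numClosedFieldType) (n : nat) :
  (0 < n)%N -> exists w : C, n.-primitive_root w.
Proof.
move=> n_gt0; have [r Dr] := closed_field_poly_normal ('X^n - 1 : {poly C}).
rewrite (monicP _) ?monicXnsubC // scale1r in Dr.
(* In characteristic zero ['X^n - 1] is separable, so its [n] roots are distinct. *)
have r_uniq : uniq r.
  by rewrite -separable_prod_XsubC -Dr separable_Xn_sub_1 // pnatr_eq0 -lt0n.
have size_r : size r = n.
  by have := size_XnsubC (1 : C) n_gt0; rewrite Dr size_prod_XsubC => -[].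
have /hasP[w _ w_prim] : has n.-primitive_root r.
  apply: has_prim_root; rewrite ?size_r //.
  by apply/allP=> z; rewrite -root_prod_XsubC -Dr.
by exists w.
Qed.

(** Taking determinants in [(X - A) V = V (X - B)] and cancelling [\det V] avoids inverting [V]. *)
Lemma char_poly_intertwine (F : fieldType) (m : nat) (A B V : 'M[F]_m) :
  V \in unitmx -> A *m V = V *m B -> char_poly A = char_poly B.
Proof.
move=> V_unit AV; have detV : \det (map_mx polyC V) != 0.
  by rewrite det_map_mx polyC_eq0 -unitfE -unitmxE.
apply: (mulIf detV); rewrite /char_poly -det_mulmx mulrC -det_mulmx.
by rewrite mulmxBl mulmxBr -!map_mxM AV scalar_mxC.
Qed.

Lemma val_addZ (n : nat) (x y : 'Z_n) :
  (1 < n)%N -> (x + y : 'Z_n) = ((x + y) %% n)%N :> nat.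
Proof. by move=> n1 /=; congr (_ %% _)%N; rewrite Zp_cast. Qed.

(** When [S = -S], these pairs correspond to the triples of [S] with sum zero, via
    [c = -(a + b)]. *)
Definition additive_pairs (n : nat) (S : {set 'Z_n}) : {set 'Z_n * 'Z_n} :=
  [set p | [&& p.1 \in S, p.2 \in S & p.1 + p.2 \in S]].

Lemma big_Zp (R : Type) (idx : R) (op : Monoid.law idx) (n : nat)
    (F : nat -> R) :
  (1 < n)%N -> \big[op/idx]_(j : 'Z_n) F j = \big[op/idx]_(j < n) F j.
Proof. by move=> n1; rewrite -(big_mkord xpredT) Zp_cast // big_mkord. Qed.

(** * Characters and the spectrum of a circulant graph *)

Section CirculantSpectrum.

Variables (C : numClosedFieldType) (n : nat) (w : C).
Hypotheses (n1 : (1 < n)%N) (w_prim : n.-primitive_root w).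

Lemma expr_addZ (j : nat) (x y : 'Z_n) :
  w ^+ (j * (x + y)%R) = w ^+ (j * x) * w ^+ (j * y).
Proof.
rewrite val_addZ // -exprD -mulnDr -(prim_expr_mod w_prim) modnMmr.
exact: prim_expr_mod.
Qed.

Lemma sum_expr_prim_root (x : 'Z_n) :
  \sum_(j : 'Z_n) w ^+ (j * x) = if x == 0 then n%:R else 0.
Proof.
under eq_bigr do rewrite mulnC exprM.
rewrite (big_Zp _ (fun j => (w ^+ x) ^+ j)) //.
case: eqP => [->|/eqP x0].
  under eq_bigr do rewrite expr0 expr1n.
  by rewrite sumr_const card_ord.
(* Geometric sum with ratio [w ^+ x], which differs from 1 because [0 < x < n]. *)
have wx : w ^+ x - 1 != 0.
  rewrite subr_eq0 -(prim_order_dvd w_prim) gtnNdvd ?ltn_Zp //.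
  by rewrite lt0n.
apply: (mulfI wx); rewrite -subrX1 mulr0 -exprM mulnC exprM.
by rewrite (prim_expr_order w_prim) expr1n subrr.
Qed.

Definition charsum (S : {set 'Z_n}) (j : nat) : C :=
  \sum_(x in S) w ^+ (j * x).

Lemma eigenvalues_circulant (S : {set 'Z_n}) :
  perm_eq (eigenvalues (adjacency C (circulant S)))
          [seq charsum S (j : nat) | j : 'Z_n].
Proof.
pose V : 'M[C]_((Zp_trunc n).+2) := \matrix_(i, j) w ^+ (j * i).
pose V' : 'M[C]_((Zp_trunc n).+2) := \matrix_(j, l) w ^+ (j * (- (l : 'Z_n))%R).
pose d : 'rV[C]_((Zp_trunc n).+2) := \row_j charsum S j.
(* Orthogonality of characters: [V'] is [n] times the inverse of the Fourier matrix [V]. *)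
have VV' : V *m V' = n%:R%:M.
  apply/matrixP=> i l; rewrite !mxE.
  under eq_bigr do rewrite !mxE -expr_addZ.
  by rewrite (sum_expr_prim_root (i - l)) subr_eq0; case: eqP.
have V_unit : V \in unitmx.
  have : V *m (n%:R^-1 *: V') = 1%:M.
    rewrite -scalemxAr VV' scale_scalar_mx mulVf // pnatr_eq0; lia.
  by case/mulmx1_unit.
have AV : adjacency C (circulant S) *m V = V *m diag_mx d.
  apply/matrixP=> i j; rewrite mul_mx_diag !mxE.
  under eq_bigr do rewrite !mxE.
  (* The neighbours of [i] are the [i + x] with [x] in [S], so a factor [w ^+ (j * i)] comes out. *)
  rewrite (reindex_inj (addrI (i : 'Z_n))) mulr_sumr [RHS]big_mkcond /=.
  apply: eq_bigr => x _; rewrite /circulant addrC addKr expr_addZ.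
  by case: ifP => _; rewrite ?mul1r ?mul0r // mulrC.
apply: prod_XsubC_eq; rewrite -eigenvaluesP (char_poly_intertwine V_unit AV).
rewrite char_poly_trig ?diag_mx_is_trig // big_image /=.
by apply: eq_bigr => j _; rewrite !mxE eqxx mulr1n.
Qed.

(** Expand the cube over triples [(a, b, c)] of [S] and sum over [j] first: orthogonality keeps only
    those with [a + b + c = 0], each with weight [n]. *)
Lemma sum_charsum_cube (S : {set 'Z_n}) : connection_set S ->
  \sum_(j : 'Z_n) charsum S j ^+ 3 = (n * #|additive_pairs S|)%:R.
Proof.
move=> [_ SN]; have memN x : (- x \in S) = (x \in S).
  by rewrite -{1}SN mem_imset //; apply: oppr_inj.
transitivity (\sum_(p : 'Z_n * 'Z_n | (p.1 \in S) && (p.2 \in S))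
    \sum_(c in S) \sum_(j : 'Z_n) w ^+ (j * (p.1 + p.2 + c)%R)).
  rewrite (eq_bigr _ (fun p _ => exchange_big _ _ _ _ _ _)) exchange_big.
  apply: eq_bigr => j _; rewrite exprSr expr2 /charsum big_distrlr.
  rewrite (pair_big (mem S) (mem S)
    (fun a b : 'Z_n => w ^+ (j * a) * w ^+ (j * b))).
  rewrite mulr_suml; apply: eq_bigr => p _; rewrite mulr_sumr.
  by apply: eq_bigr => c _; rewrite !expr_addZ.
have sum_c y : \sum_(c in S) \sum_(j : 'Z_n) w ^+ (j * (y + c)%R) =
    if y \in S then n%:R else 0.
  under eq_bigr do rewrite sum_expr_prim_root // addrC addr_eq0.
  rewrite -big_mkcondr -memN /=; case: ifP => yS.
    by rewrite (big_pred1 (- y)) // => c /=; case: eqP => [->|]; rewrite ?yS ?andbF.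
  by rewrite big_pred0 // => c; case: eqP => [->|]; rewrite ?yS ?andbF.
under eq_bigr do rewrite sum_c.
rewrite -big_mkcondr natrM mulr_natr -sumr_const.
by apply: eq_bigl => p; rewrite !inE andbA.
Qed.

Lemma charsum_translate (S : {set 'Z_n}) (t : 'Z_n) (j : nat) :
  charsum [set x | x - t \in S] j = w ^+ (j * t) * charsum S j.
Proof.
rewrite /charsum (reindex_inj (addrI t)) mulr_sumr /=.
by apply: eq_big => [x|x _]; rewrite ?inE 1?addrC ?addKr // expr_addZ // mulrC.
Qed.

End CirculantSpectrum.

(** * Translation by [k] and the reflection of [s] to [k - 1 - s] *)

Section AntipodalTranslate.

Variables (C : numClosedFieldType) (k : nat) (w : C).
Local Notation n := (2 * k)%N.
Hypotheses (k1 : (1 < k)%N) (w_prim : n.-primitive_root w).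

Let n1 : (1 < n)%N. Proof. lia. Qed.

Lemma prim_root_half : w ^+ k = -1.
Proof.
have /eqP : (w ^+ k) ^+ 2 = 1 by rewrite -exprM mulnC (prim_expr_order w_prim).
rewrite sqrf_eq1 -(prim_order_dvd w_prim) gtnNdvd //=; try lia.
by move/eqP.
Qed.

Lemma val_halfZ : (k%:R : 'Z_n) = k :> nat.
Proof. by rewrite val_Zp_nat // modn_small //; lia. Qed.

Lemma conn2_translate (s : nat) : (s < k)%N ->
  conn2 n k s = [set x | x - k%:R \in conn1 n s].
Proof.
move=> sk; apply/setP=> x; rewrite !inE.
have := val_addZ x (- k%:R) n1; have := val_oppZ (k%:R : 'Z_n) n1.
rewrite val_halfZ; case: eqP => [|_ ->]; first by lia.
move=> ->; have := ltn_Zp x n1; case: (leqP k x) => kx xn.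
  by rewrite (_ : x + (n - k) = (x - k) + n)%N ?modnDr ?modn_small; lia.
by rewrite modn_small; lia.
Qed.

Lemma charsum_conn2 (s j : nat) : (s < k)%N ->
  charsum w (conn2 n k s) j = (-1) ^+ j * charsum w (conn1 n s) j.
Proof.
move=> sk; rewrite conn2_translate // charsum_translate // val_halfZ.
by rewrite mulnC exprM prim_root_half.
Qed.

(* The sets [conn1 n s], [conn2 n k (k - 1 - s)] and [{0, k}] partition Z_n. *)
Lemma charsum_conn1_reflect (s : nat) (j : 'Z_n) : (s < k)%N -> odd j ->
  charsum w (conn1 n s) j = charsum w (conn1 n (k - 1 - s)) j.
Proof.
move=> sk j_odd; have j0 : j != 0 by apply: contraL j_odd => /eqP ->.
have := sum_expr_prim_root n1 w_prim j; rewrite (negPf j0).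
under eq_bigr do rewrite mulnC.
rewrite (bigID (mem (conn1 n s))) /=.
rewrite [X in _ + X](bigID (mem (conn2 n k (k - 1 - s)))) /=.
rewrite [X in _ + (_ + X)](bigD1 (0 : 'Z_n)) /=; last by rewrite !inE /=; lia.
rewrite [X in _ + (_ + (_ + X))](bigD1 (k%:R : 'Z_n)) /=; last first.
  by rewrite !inE -val_eqE /= val_halfZ; lia.
rewrite [X in _ + (_ + (_ + (_ + X)))]big1 => [|x]; last first.
  by rewrite !inE -!val_eqE /= val_halfZ; have := ltn_Zp x n1; lia.
rewrite muln0 expr0 val_halfZ [(j * k)%N]mulnC exprM prim_root_half.
rewrite [X in _ + (X + _)](eq_bigl (mem (conn2 n k (k - 1 - s)))) => [|x];
  last first.
  by rewrite !inE; have := ltn_Zp x n1; lia.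
rewrite -/(charsum w (conn1 n s) j) -/(charsum w (conn2 n k _) j).
rewrite charsum_conn2; last by lia.
(* For odd [j] the terms of 0 and [k] cancel, as [1 + (-1)^j = 0], and the [conn2] part is minus a
   [conn1] sum. *)
rewrite -signr_odd j_odd expr1 addr0 subrr addr0 mulN1r => /eqP.
by rewrite subr_eq0 => /eqP.
Qed.

Lemma sum_cube_defect_reflect (s : nat) : (s < k)%N ->
  \sum_(j : 'Z_n) charsum w (conn1 n s) j ^+ 3
    - \sum_(j : 'Z_n) charsum w (conn2 n k s) j ^+ 3 =
  \sum_(j : 'Z_n) charsum w (conn1 n (k - 1 - s)) j ^+ 3
    - \sum_(j : 'Z_n) charsum w (conn2 n k (k - 1 - s)) j ^+ 3.
Proof.
move=> sk; rewrite -!sumrB; apply: eq_bigr => j _.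
rewrite !charsum_conn2 -1?signr_odd; [|lia|lia].
have [j_odd|_] := boolP (odd j); last by rewrite expr0 !mul1r !subrr.
by rewrite (charsum_conn1_reflect sk j_odd).
Qed.

End AntipodalTranslate.

(** * Comparing the numbers of additive pairs *)

Section AdditivePairsCount.

Local Open Scope nat_scope.

(** Membership in [conn1] and [conn2] on representatives, kept in [nat] so that [lia] applies. *)
Definition near_zero (n s x : nat) := (1 <= x <= s) || (n - s <= x <= n - 1).
Definition near_half (k s x : nat) :=
  (k - s <= x <= k - 1) || (k + 1 <= x <= k + s).

(* Pairs in [S_2] whose sum is in [S_2] are [(k + u, k + v)] and [(k - u, k - v)]
   with [1 <= u, v <= s] and [k - s <= u + v]. Send [(u, v)] to
   [(s + 1 - u, s + 1 - v)], whose sum is at most [s] unless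
   [u + v = s + 1] (which forces [k = 2 * s + 1]); in that case the second
   component is taken negative, written modulo [2 * k]. *)
Definition reflect_half (k s u v : nat) : nat * nat :=
  (s + 1 - u, if s + 1 - u < v then s + 1 - v
              else if 1 < u then 2 * k - s else 2 * k - 1).

(** Pairs below [k] are negated, mapped like those above [k], and negated back. *)
Definition reflect_pair (k s a b : nat) : nat * nat :=
  if k < a then reflect_half k s (a - k) (b - k)
  else let q := reflect_half k s (k - a) (k - b) in
       (2 * k - q.1, 2 * k - q.2).

Lemma modnD_small (n a b : nat) : a < n -> b < n ->
  (a + b) %% n = if a + b < n then a + b else a + b - n.
Proof.
move=> an bn; case: ltnP => abn; first by rewrite modn_small.
by rewrite -{1}(subnK abn) modnDr modn_small //; lia.
Qed.

(** On opposite sides, [k + u] and [k - v] add up to [u - v] modulo [2 * k], which is less than [s]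
    away from 0, whereas elements of [S_2] are at least [k - s > s] away. *)
Lemma near_half_add_same_side (k s a b : nat) : 2 * s < k ->
  near_half k s a -> near_half k s b -> near_half k s ((a + b) %% (2 * k)) ->
  [/\ k < a <= k + s, k < b <= k + s & 3 * k - s <= a + b] \/
  [/\ k - s <= a < k, k - s <= b < k & a + b <= k + s].
Proof.
rewrite /near_half => sk ia ib; rewrite modnD_small; try lia.
by case: ifP => abn iab; (case: (ltnP k a) => ka; [left|right]); split; lia.
Qed.

(** Since [k - s >= s + 1], the reflected sum [2 * s + 2 - (u + v)] is at most [s + 1]. In the
    exceptional case [k = 2 * s + 1], the value [(1, -2)] would need [u = s = 2], hence [k = 5]. *)
Lemma reflect_half_in (k s u v : nat) :
  6 <= k -> 2 <= s -> 2 * s < k ->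
  1 <= u <= s -> 1 <= v <= s -> k - s <= u + v ->
  let q := reflect_half k s u v in
  [/\ 1 <= q.1 <= s,
      (1 <= q.2 < s) && (q.1 + q.2 <= s)
      || (2 * k - s <= q.2 <= 2 * k - 1) && (q.1 + q.2 != 2 * k)
    & ~~ ((q.1 == 1) && (q.2 == 2 * k - 2))].
Proof.
move=> k6 s2 sk iu iv iuv; rewrite /reflect_half /=.
by case: ifP => c1; [|case: ifP => c2]; split; lia.
Qed.

(** The first component gives [u]. The second gives [v] if it is small; if it is large, the
    exceptional case holds and [v = s + 1 - u]. *)
Lemma reflect_half_inj (k s u v u' v' : nat) : 2 * s < k ->
  1 <= u <= s -> 1 <= v <= s -> k - s <= u + v ->
  1 <= u' <= s -> 1 <= v' <= s -> k - s <= u' + v' ->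
  reflect_half k s u v = reflect_half k s u' v' -> u = u' /\ v = v'.
Proof.
move=> sk iu iv iuv iu' iv' iuv' [eu].
have eq_u : u = u' by lia.
subst u'.
by case: (ltnP (s + 1 - u) v) => c1; case: (ltnP (s + 1 - u) v') => c2;
  case: (ltnP 1 u) => c3 e; split; lia.
Qed.

Lemma reflect_pair_in (k s a b : nat) :
  6 <= k -> 2 <= s -> 2 * s < k ->
  near_half k s a -> near_half k s b -> near_half k s ((a + b) %% (2 * k)) ->
  let q := reflect_pair k s a b in
  [/\ near_zero (2 * k) s q.1, near_zero (2 * k) s q.2,
      near_zero (2 * k) s ((q.1 + q.2) %% (2 * k)) &
      ~~ ((q.1 == 1) && (q.2 == 2 * k - 2))].
Proof.
move=> k6 s2 sk ia ib iab; have := near_half_add_same_side sk ia ib iab.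
rewrite /near_zero /reflect_pair => {ia ib iab}.
case=> -[/andP[ka ia] ib iab].
  rewrite ka; have := @reflect_half_in k s (a - k) (b - k) k6 s2 sk.
  case: (reflect_half _ _ _ _) => c d /= []; [lia | lia | lia |].
  move=> ic id icd; rewrite modnD_small; [|lia|lia].
  by case: ifP => icd'; split; lia.
rewrite (ltnNge k) (ltnW ia).
have := @reflect_half_in k s (k - a) (k - b) k6 s2 sk.
case: (reflect_half _ _ _ _) => c d /= []; [lia | lia | lia |].
move=> ic id icd; rewrite modnD_small; [|lia|lia].
by case: ifP => icd'; split; lia.
Qed.

Lemma reflect_pair_inj (k s a b a' b' : nat) :
  6 <= k -> 2 <= s -> 2 * s < k ->
  near_half k s a -> near_half k s b -> near_half k s ((a + b) %% (2 * k)) ->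
  near_half k s a' -> near_half k s b' ->
  near_half k s ((a' + b') %% (2 * k)) ->
  reflect_pair k s a b = reflect_pair k s a' b' -> a = a' /\ b = b'.
Proof.
move=> k6 s2 sk ia ib iab ia' ib' iab'.
have := near_half_add_same_side sk ia ib iab.
have := near_half_add_same_side sk ia' ib' iab'.
rewrite /reflect_pair => {ia ib iab ia' ib' iab'}.
case=> -[/andP[la' ra'] ib' iab'] [] [/andP[la ra] ib iab].
- rewrite la la' => /reflect_half_inj[]; lia.
(* Opposite sides: one first component is at most [s], the other at least [2 * k - s]. *)
- by rewrite la' (ltnNge k) (ltnW ra) /=; case; rewrite /reflect_half /=; lia.
- by rewrite la (ltnNge k) (ltnW ra') /=; case; rewrite /reflect_half /=; lia.
- rewrite !(ltnNge k) (ltnW ra) (ltnW ra').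
  (* The bounds on the components are what allows cancelling the truncated subtraction from
     [2 * k]. *)
  have := @reflect_half_in k s (k - a) (k - b) k6 s2 sk.
  have := @reflect_half_in k s (k - a') (k - b') k6 s2 sk.
  have := @reflect_half_inj k s (k - a) (k - b) (k - a') (k - b') sk.
  case: (reflect_half k s (k - a) _) => c d.
  case: (reflect_half k s (k - a') _) => c' d' /=.
  move=> inj [||| ic' id' _]; [lia | lia | lia |].
  move=> [||| ic id _]; [lia | lia | lia |].
  case=> ec ed.
  have Ec : c = c' by clear inj; lia.
  have Ed : d = d' by clear inj; lia.
  clear ic id ic' id' ec ed.
  by case: inj; rewrite ?Ec ?Ed //; lia.
Qed.

Lemma card_additive_pairs_lt (k s : nat) : 6 <= k -> 2 <= s -> 2 * s < k ->
  #|additive_pairs (conn2 (2 * k) k s)| < #|additive_pairs (conn1 (2 * k) s)|.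
Proof.
move=> k6 s2 sk; have n1 : 1 < 2 * k by lia.
have natZ (m : nat) : m < 2 * k -> (m%:R : 'Z_(2 * k)) = m :> nat.
  by move=> mn; rewrite val_Zp_nat // modn_small.
pose f (p : 'Z_(2 * k) * 'Z_(2 * k)) : 'Z_(2 * k) * 'Z_(2 * k) :=
  let q := reflect_pair k s p.1 p.2 in (q.1%:R, q.2%:R)%R.
have mem1 p : (p \in additive_pairs (conn1 (2 * k) s)) =
    [&& near_zero (2 * k) s p.1, near_zero (2 * k) s p.2
      & near_zero (2 * k) s ((p.1 + p.2) %% (2 * k))].
  by rewrite 4!inE val_addZ.
have mem2 p : (p \in additive_pairs (conn2 (2 * k) k s)) =
    [&& near_half k s p.1, near_half k s p.2
      & near_half k s ((p.1 + p.2) %% (2 * k))].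
  by rewrite 4!inE val_addZ.
have valf p : p \in additive_pairs (conn2 (2 * k) k s) ->
    (f p).1 = (reflect_pair k s p.1 p.2).1 :> nat /\
    (f p).2 = (reflect_pair k s p.1 p.2).2 :> nat.
  rewrite mem2 => /and3P[h1 h2 h3].
  have [/= q1 q2 _ _] := reflect_pair_in k6 s2 sk h1 h2 h3.
  by rewrite /f /= !natZ //; move: q1 q2; rewrite /near_zero; lia.
have f_inj : {in additive_pairs (conn2 (2 * k) k s) &, injective f}.
  move=> p p' pA p'A eq_f; have [f1 f2] := valf p pA; have [f1' f2'] := valf p' p'A.
  move: pA p'A; rewrite !mem2 => /and3P[h1 h2 h3] /and3P[h1' h2' h3'].
  have [] : p.1 = p'.1 :> nat /\ p.2 = p'.2 :> nat.
    apply: (reflect_pair_inj k6 s2 sk h1 h2 h3 h1' h2' h3').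
    by apply: injective_projections; rewrite -?f1 -?f2 -?f1' -?f2' eq_f.
  by move=> /val_inj e1 /val_inj e2; apply: injective_projections.
rewrite -(card_in_imset f_inj); apply: proper_card; apply/properP; split.
  apply/subsetP=> _ /imsetP[p pA ->]; have [f1 f2] := valf p pA.
  move: pA; rewrite mem1 mem2 f1 f2 => /and3P[h1 h2 h3].
  by have [/= -> -> ->] := reflect_pair_in k6 s2 sk h1 h2 h3.
(* The pair [(1, -2)], with sum [-1], lies in [S_1] because [s >= 2], and is never a value of
   [f]. *)
exists (1%:R, (2 * k - 2)%:R)%R.
  rewrite mem1 /= natZ; last by lia.
  rewrite Zp_cast // (modn_small n1).
  by rewrite modn_small /near_zero; lia.
apply/imsetP=> -[p pA] [e1 e2]; have [f1 f2] := valf p pA.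
move: pA; rewrite mem2 => /and3P[h1 h2 h3].
have [_ _ _] := reflect_pair_in k6 s2 sk h1 h2 h3.
by rewrite -f1 -f2 /f -e1 -e2 !natZ ?eqxx //; lia.
Qed.

End AdditivePairsCount.

(** * Comparison of the two spectra *)

Theorem theorem4p4 (C : numClosedFieldType) (k n s : nat)
  (hk : (6 <= k)%N) (hn : n = (2 * k)%N) (hs : (2 <= s <= k - 3)%N) :
  singularly_cospectral C (circulant (conn1 n s)) (circulant (conn2 n k s)) /\
  ~ cospectral C (circulant (conn1 n s)) (circulant (conn2 n k s)).
Proof.
subst n; have n1 : (1 < 2 * k)%N by lia.
have k1 : (1 < k)%N by lia.
have sk : (s < k)%N by lia.
have [w w_prim] := @prim_root_exists_closed C (2 * k)%N (ltnW n1).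
have spec S := eigenvalues_circulant n1 w_prim S.
split.
  apply: (perm_trans (perm_map _ (perm_filter _ (spec _)))).
  rewrite perm_sym; apply: (perm_trans (perm_map _ (perm_filter _ (spec _)))).
  rewrite !filter_map -!map_comp.
  (* The sign [(-1)^j] changes neither which terms vanish nor their absolute values. *)
  rewrite (@eq_filter _ _ (fun j : 'Z_(2 * k) =>
    charsum w (conn1 (2 * k) s) j != 0)) => [|j /=]; last first.
    by rewrite charsum_conn2 // mulf_eq0 signr_eq0.
  rewrite (@eq_map _ _ _ (fun j : 'Z_(2 * k) =>
    `|charsum w (conn1 (2 * k) s) j|)) // => j /=.
  by rewrite charsum_conn2 // normrM normr_sign mul1r.
move=> cosp; have {cosp} eq_cube :
    \sum_(j : 'Z_(2 * k)) charsum w (conn1 (2 * k) s) j ^+ 3 =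
    \sum_(j : 'Z_(2 * k)) charsum w (conn2 (2 * k) k s) j ^+ 3.
  have cube (S : {set 'Z_(2 * k)}) : \sum_(j : 'Z_(2 * k)) charsum w S j ^+ 3 =
      \sum_(x <- eigenvalues (adjacency C (circulant S))) x ^+ 3.
    by rewrite (perm_big _ (spec S)) big_image.
  by rewrite !cube; apply: perm_big.
have cube_neq t : (2 <= t)%N -> (2 * t < k)%N ->
    \sum_(j : 'Z_(2 * k)) charsum w (conn1 (2 * k) t) j ^+ 3 !=
    \sum_(j : 'Z_(2 * k)) charsum w (conn2 (2 * k) k t) j ^+ 3.
  move=> t2 tk.
  have S1 : connection_set (conn1 (2 * k) t) by apply: conn1_connection_set; lia.
  have S2 : connection_set (conn2 (2 * k) k t).
    by apply: conn2_connection_set => //; lia.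
  rewrite (sum_charsum_cube n1 w_prim S1) (sum_charsum_cube n1 w_prim S2).
  rewrite eqr_nat eqn_pmul2l ?(ltnW n1) // eq_sym ltn_eqF //.
  exact: card_additive_pairs_lt.
have [tk|tk] := ltnP (2 * s) k.
  have s2 : (2 <= s)%N by lia.
  by have /eqP := cube_neq s s2 tk.
(* Here [k <= 2 * s], so [t = k - 1 - s] satisfies [2 * t < k], and [s <= k - 3] gives [t >= 2]. *)
have := sum_cube_defect_reflect k1 w_prim sk.
rewrite eq_cube subrr => /esym/eqP; rewrite subr_eq0; apply/negP.
by apply: cube_neq; lia.
Qed.
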